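(* Let $\Gamma$ be a $\delta$-hyperbolic group, let $\bar\sigma$ be an automorphism of $\Gamma$ of finite order $m$, and let $\bar\sigma_\infty$ be the induced action of $\bar\sigma$ on the boundary at infinity $\partial^\infty\Gamma$. Then the fixed point set $(\partial^\infty\Gamma)^{\bar\sigma_\infty}$ is homeomorphic to $\partial^\infty(\Gamma^{\bar\sigma})$, the boundary at infinity of the fixed subgroup $\Gamma^{\bar\sigma}$.
   Context: A $\delta$-hyperbolic group is a finitely generated group that is word hyperbolic in the sense of Gromov, and $\partial^\infty\Gamma$ denotes its Gromov boundary (boundary at infinity). An automorphism of $\Gamma$ is a quasi-isometry of any Cayley graph of $\Gamma$ (with respect to a finite generating set) and hence induces a homeomorphism of $\partial^\infty\Gamma$; for $\bar\sigma$ this homeomorphism is denoted $\bar\sigma_\infty$, and $(\partial^\infty\Gamma)^{\bar\sigma_\infty}=\{x\in\partial^\infty\Gamma : \bar\sigma_\infty(x)=x\}$ carries the subspace topology. The fixed subgroup is $\Gamma^{\bar\sigma}=\{g\in\Gamma : \bar\sigma(g)=g\}$. By a theorem of W. D. Neumann, it is quasi-convex in $\Gamma$, hence itself a hyperbolic group, so $\partial^\infty(\Gamma^{\bar\sigma})$ is defined. *)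

(* Defs.v *)
From HB Require Import structures.
From mathcomp Require Import all_boot all_order all_algebra.
From mathcomp Require Import all_classical all_reals all_analysis.
Set Implicit Arguments.
Unset Strict Implicit.
Unset Printing Implicit Defensive.
Import Order.TTheory GRing.Theory Num.Theory.
Local Open Scope classical_set_scope.
Local Open Scope ring_scope.

Section WordMetric.
Context {G : groupType}.
Implicit Types (S : seq G) (g x y z w : G) (n : nat).

Definition word_of_size S g n : Prop :=
  exists2 v : seq G, {subset v <= S ++ [seq s^-1 | s <- S]%g} &
    size v = n /\ (\prod_(s <- v) s)%g = g.

Definition generates S : Prop := forall g, exists n, word_of_size S g n.

(* The default value 0 is only taken when no word in S represents g, which
   never happens when S generates G. *)
Definition word_length S g : nat :=
  xget 0%N [set n | word_of_size S g n /\
                    forall k, word_of_size S g k -> (n <= k)%N].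

(* The left-invariant metric of the Cayley graph, restricted to vertices. *)
Definition word_dist S x y : nat := word_length S (x^-1 * y)%g.

Definition gromov_product S w x y : rat :=
  ((word_dist S x w)%:R + (word_dist S y w)%:R - (word_dist S x y)%:R) / 2.

(* Gromov's four-point inequality; a constant valid for the vertex set differs
   from one valid for the whole Cayley graph by a bounded amount, and rational
   delta suffices since any larger delta works as well. *)
Definition hyperbolic_wrt S : Prop :=
  exists delta : rat, forall w x y z,
    Num.min (gromov_product S w x y) (gromov_product S w y z) - delta
      <= gromov_product S w x z.

End WordMetric.

Definition hyperbolic_group (G : groupType) : Prop :=
  exists2 S : seq G, generates S & hyperbolic_wrt S.

Section Boundary.
Context {G : groupType} (S : seq G).
Implicit Types (x y : nat -> G) (r : rat).

(* Since Gromov products are half-integers, this says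
   liminf_(i, j -> oo) (x_i | y_j)_1 >= r. *)
Definition eventually_ge x y r : Prop :=
  exists N : nat, forall i j, (N <= i)%N -> (N <= j)%N ->
    r <= gromov_product S 1%g (x i) (y j).

Definition gromov_equiv x y : Prop := forall r, eventually_ge x y r.

Definition gromov_sequence x : Prop := gromov_equiv x x.

Definition gromov_class x : set (nat -> G) :=
  [set y | gromov_sequence y /\ gromov_equiv x y].

Definition boundary : Type :=
  {p : set (nat -> G) | exists2 x, gromov_sequence x & p = gromov_class x}.

HB.instance Definition _ := gen_eqMixin boundary.
HB.instance Definition _ := gen_choiceMixin boundary.

Definition boundary_ball (p : boundary) r : set boundary :=
  [set q | exists x y, [/\ sval p x, sval q y & eventually_ge x y r]].

(* The sets boundary_ball p r, r : rat, are a basis of neighbourhoods of p. *)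
Definition boundary_open (U : set boundary) : Prop :=
  forall p, U p -> exists r, boundary_ball p r `<=` U.

Lemma boundary_ballS p r r' : r <= r' -> boundary_ball p r' `<=` boundary_ball p r.
Proof.
move=> rr' q [x [y [px qy [N xyN]]]]; exists x, y; split=> //; exists N => i j Ni Nj.
exact: le_trans rr' (xyN i j Ni Nj).
Qed.

Lemma boundary_openT : boundary_open setT.
Proof. by move=> p _; exists 0. Qed.

Lemma boundary_openI : setI_closed boundary_open.
Proof.
move=> A B oA oB p [/oA[r rA] /oB[s sB]]; exists (Num.max r s) => q pq.
by split; [apply: rA | apply: sB]; apply: boundary_ballS pq;
  rewrite le_max lexx ?orbT.
Qed.

Lemma boundary_open_bigU (I : Type) (f : I -> set boundary) :
  (forall i, boundary_open (f i)) -> boundary_open (\bigcup_i f i).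
Proof.
move=> fo p [i _ /fo[r rf]]; exists r => q /rf fq; by exists i.
Qed.

HB.instance Definition _ := isOpenTopological.Build boundary
  boundary_openT boundary_openI boundary_open_bigU.

End Boundary.

Section FixedSubgroup.
Context {G : groupType} (sigma : UMagmaMorphism.type G G).

Definition fixed_pred : {pred G} := [pred g | sigma g == g].

Definition fixed_subgroup : Type := {g : G | g \in fixed_pred}.

Lemma fixed_group_closed : group_closed fixed_pred.
Proof.
split; first by rewrite inE gmulf1.
by move=> g h; rewrite !inE => /eqP gE /eqP hE; rewrite gmulfF gE hE.
Qed.

HB.instance Definition _ := SubChoice.on fixed_subgroup.
HB.instance Definition _ :=
  SubChoice_isSubGroup.Build G fixed_pred fixed_subgroup fixed_group_closed.

End FixedSubgroup.

Definition automorphism_of_order (G : groupType) (sigma : G -> G) (m : nat) : Prop :=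
  [/\ bijective sigma, (0 < m)%N, iter m sigma =1 id &
      forall k, (0 < k < m)%N -> ~ (iter k sigma =1 id)].

(* The induced map [x] |-> [sigma \o x], as the direct image of the class p.
   When sigma is an automorphism and p is a boundary point of a hyperbolic
   group, this direct image is again a full equivalence class, because sigma
   and its inverse are quasi-isometries. *)
Definition boundary_map (G : groupType) (S : seq G) (sigma : G -> G)
    (p : boundary S) : set (nat -> G) :=
  [set sigma \o x | x in sval p].

Definition boundary_fixed (G : groupType) (S : seq G) (sigma : G -> G) :
    set (boundary S) :=
  [set p | boundary_map sigma p = sval p].
Arguments boundary_fixed {G} S sigma.

Definition homeomorphic (X Y : topologicalType) : Prop :=
  exists (f : X -> Y) (g : Y -> X),
    [/\ continuous f, continuous g, cancel f g & cancel g f].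

(* Main.v *)
Require Import Defs.
From HB Require Import structures.
From mathcomp Require Import all_boot all_order all_algebra.
From mathcomp Require Import all_classical all_reals all_analysis.
From mathcomp Require Import zify lra.
Set Implicit Arguments.
Unset Strict Implicit.
Unset Printing Implicit Defensive.
Import Order.TTheory GRing.Theory Num.Theory.

(** Let H be the fixed subgroup.  Replacing a finite generating set S of Gamma
    by the union S' of its images under the powers of sigma, sigma becomes an
    isometry of the word metric.  This is where finite order enters, and it
    makes everything rest on one picture.  A geodesic from 1 to x and its image
    under sigma, a geodesic from 1 to sigma x, stay uniformly close to each
    other up to time (x | sigma x)_1 by hyperbolicity.  So a point y of the
    first one, up to that time, satisfies y^-1 * sigma y = u with u in a fixed
    finite ball.  If z has the same displacement u then y * z^-1 is fixed by
    sigma; taking one z for each u in the ball, y is within a uniform distance R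
    of H ([fixed_near_geodesic]).

    For x in H the whole geodesic from 1 to x is R-close to H.  Walking along it
    writes x as a product of |x| + 1 elements of H of length at most 2 R + 1, so
    H is finitely generated and undistorted ([fixed_subgroup_undistorted]).
    Hence the inclusion of H is bilipschitz for all choices of generators, H is
    hyperbolic, and Gromov products in H and in Gamma go to infinity together.
    Sending the class of (h_i) in H to its class in Gamma is therefore well
    defined, injective, and continuous both ways onto its image; the image
    consists of fixed points.  Conversely, if (x_i) represents a fixed point
    then (x_i | sigma x_i)_1 tends to infinity, and the points of H close to the
    geodesics from 1 to x_i at time (x_i | sigma x_i)_1 represent the same
    boundary point ([fixed_sequence]), so every fixed point is in the image.

    The comparison of Gromov products for two generating sets of Gamma, such as
    S and S', and for H and Gamma is an instance of the invariance of
    hyperbolicity and, coarsely, of Gromov products under bilipschitz embeddings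
    of graphs, which rests on the Morse lemma ([geodesic_near_path],
    [path_near_geodesic]).  It is proved from the four-point condition: along a
    chain of 2 ^ k steps the Gromov product drops by at most a multiple of k,
    whereas a bilipschitz path making a detour at distance r from a point of the
    geodesic has length linear in r.

    All metric arguments use doubled Gromov products, which are natural numbers
    for word metrics. *)

(** * Hyperbolicity of graph metrics *)

Section Metric.
Variables (X : Type) (d : X -> X -> nat).

Definition geodesic x y (g : nat -> X) : Prop :=
  [/\ g 0 = x, g (d x y) = y &
      forall i j, i <= j -> j <= d x y -> d (g i) (g j) = j - i].

(** The distance on the vertices of a connected graph. *)
Record graph_metric : Prop := GraphMetric {
  gm_refl : forall x, d x x = 0;
  gm_sym : forall x y, d x y = d y x;
  gm_triangle : forall x y z, d x z <= d x y + d y z;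
  gm_geodesic : forall x y, exists g, geodesic x y g }.

(** Twice the Gromov product of [x] and [y] based at [w]; the subtraction never
    truncates in a metric space. *)
Definition gromov2 w x y := d x w + d y w - d x y.

(** [D] is twice the usual constant, since the products are doubled. *)
Definition hyperbolic D := forall w x y z,
  minn (gromov2 w x y) (gromov2 w y z) <= gromov2 w x z + D.

(** [p] lies on a geodesic from [x] to [y]. *)
Definition between x p y := d x p + d p y = d x y.

Hypothesis gmX : graph_metric.
Let dxx := gm_refl gmX.
Let dC := gm_sym gmX.
Let dT := gm_triangle gmX.

Lemma geodesicL x y g t : geodesic x y g -> t <= d x y -> d x (g t) = t.
Proof. by move=> [g0 _ gE] tn; rewrite -[in LHS]g0 gE ?subn0. Qed.

Lemma geodesicR x y g t : geodesic x y g -> t <= d x y ->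
  d (g t) y = d x y - t.
Proof. by move=> [_ gn gE] tn; rewrite -[in LHS]gn gE. Qed.

Lemma dist0_eq x y : d x y = 0 -> x = y.
Proof. by move=> xy0; have [g [g0]] := gm_geodesic gmX x y; rewrite xy0 g0. Qed.

Lemma geodesic_through x p y : between x p y ->
  exists2 g, geodesic x y g & g (d x p) = p.
Proof.
rewrite /between => btw.
have [g1 gg1] := gm_geodesic gmX x p; have [g2 gg2] := gm_geodesic gmX p y.
have [g10 g1n g1E] := gg1; have [g20 g2n g2E] := gg2.
exists (fun i => if i <= d x p then g1 i else g2 (i - d x p)); last first.
  by rewrite leqnn.
split=> [//||i j leij lej].
  case: leqP => le.
    have p0 : d p y = 0 by lia.
    by have -> : d x y = d x p; [lia | rewrite g1n (dist0_eq p0)].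
  by have -> : d x y - d x p = d p y by lia.
case: (leqP j (d x p)) => [le|lt].
  by rewrite (leq_trans leij le) g1E.
case: (leqP i (d x p)) => [le'|lt']; last by rewrite g2E; lia.
have := geodesicR gg1 le'; have := geodesicL gg1 le'.
have := @geodesicR _ _ _ (j - d x p) gg2; have := @geodesicL _ _ _ (j - d x p) gg2.
have := dT (g1 i) p (g2 (j - d x p)); have := dT x (g1 i) y.
have := dT (g1 i) (g2 (j - d x p)) y; lia.
Qed.

Lemma gromov2_move w w' x y : gromov2 w x y <= gromov2 w' x y + 2 * d w w'.
Proof. by have := dT x w' w; have := dT y w' w; rewrite (dC w' w) /gromov2; lia. Qed.

Lemma gromov2_between w p x y : between x p y -> gromov2 w x y <= 2 * d w p.
Proof.
by rewrite /between /gromov2; have := dT x p w; have := dT y p w;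
  rewrite (dC y p) (dC p w); lia.
Qed.

Lemma gromov2C w x y : gromov2 w x y = gromov2 w y x.
Proof. by rewrite /gromov2 (dC x y) addnC. Qed.

Lemma hyperbolic_four_point D : hyperbolic D -> forall w x y z,
  d x z + d y w <= maxn (d x y + d z w) (d y z + d x w) + D.
Proof.
move=> hypD w x y z; have := hypD w x y z; rewrite /gromov2.
have := dT x w y; have := dT y w z; have := dT x w z.
rewrite (dC w y) (dC w z); lia.
Qed.

(** Compare [a] with the point [p] of a geodesic from [x] to [y] at the same
    distance from [x]: the four-point condition for [y, a, x, p] bounds [d a p].
    When [a] is farther from [x] than [y] is, [p] is [y] itself. *)
Lemma near_between D K a x y : hyperbolic D -> gromov2 a x y <= K ->
  exists p, between x p y /\ d a p <= K + D.
Proof.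
move=> hypD leK; have [g gg] := gm_geodesic gmX x y.
have T := dT x a y; rewrite /gromov2 (dC y a) in leK.
have [le_xy|lt_yx] := leqP (d x a) (d x y); last first.
  by exists y; rewrite /between dxx; split; lia.
exists (g (d x a)).
have dxp := geodesicL gg le_xy; have dpy := geodesicR gg le_xy.
split; first by rewrite /between; lia.
have := hyperbolic_four_point hypD y a x (g (d x a)).
by rewrite (dC a x); lia.
Qed.

Section Chain.
Variables (D : nat) (hypD : hyperbolic D) (c : nat -> X).

(** Halving the interval [i, j] costs [D] once for each level of the recursion.
    The bound on [d (c l) a] is what the chain of length 0 requires. *)
Lemma chain_gromov2 a r n k i j : i <= n -> j <= n ->
  (forall l, l < n -> r <= gromov2 a (c l) (c l.+1)) ->
  (forall l, l <= n -> r <= 2 * d (c l) a) ->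
  i <= j -> j - i <= 2 ^ k -> r <= gromov2 a (c i) (c j) + k * D.
Proof.
move=> lei lej step pt; elim: k i j lei lej => [|k IHk] i j lei lej leij.
  rewrite expn0 => lej1; have [->|lt_ij] := eqVneq i j.
    by have := pt j lej; rewrite /gromov2 dxx; lia.
  have -> : j = i.+1 by lia.
  by have := step i; lia.
rewrite expnS => le2.
pose h := i + (j - i)./2.
have h1 : i <= h <= j by rewrite /h; lia.
have := IHk i h lei; have := IHk h j; have := hypD a (c i) (c h) (c j).
by rewrite /h in h1 *; lia.
Qed.

End Chain.
End Metric.

Lemma exp_beats_linear A : exists N, forall k, N <= k -> A * k.+1 <= 2 ^ k.
Proof.
exists (2 * A + 2 * A + 4) => k leNk.
have h := odd_double_half k; set q := k./2 in h.
have e1 : q.+1 <= 2 ^ q by elim: (q) => // n; rewrite expnS; lia.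
have e2 : 2 ^ k = 2 ^ (odd k) * (2 ^ q * 2 ^ q).
  by rewrite -[in LHS]h -!expnD addnn.
have e3 : 1 <= 2 ^ odd k by rewrite expn_gt0.
have e4 : q.+1 * q.+1 <= 2 ^ k.
  by rewrite e2; apply: leq_trans (leq_pmull _ e3); apply: leq_mul.
apply: leq_trans e4.
have : (2 * A).+1 <= q by lia.
have : k <= 2 * q + 1 by lia.
by nia.
Qed.

(** The form in which logarithms enter: a quantity which is at most logarithmic
    in a multiple of itself is bounded.  It is tested on [k] about [D / (2 C)],
    for which [B + k C] is at most [B + D / 2]. *)
Lemma log_bound A B C : exists N, forall D,
  (forall k, A * D <= 2 ^ k -> D <= B + k * C) -> D <= N.
Proof.
have [N0 hN] := exp_beats_linear (A * (2 * C).+1).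
exists (2 * B + (2 * C).+1 * N0.+1) => D hD.
rewrite leqNgt; apply/negP => ltD.
pose k := D %/ (2 * C).+1.
have Dk := divn_eq D (2 * C).+1; have rk := ltn_pmod D (ltn0Sn (2 * C)).
rewrite -/k in Dk.
have leNk : N0 <= k by nia.
have := hN k leNk.
have : A * D <= A * (2 * C).+1 * k.+1.
  by rewrite -mulnA leq_mul2l; apply/orP; right; nia.
move=> h1 h2; have := hD k (leq_trans h1 h2).
by nia.
Qed.

(** * Stability of quasi-geodesics *)

Section Morse.
Variables (X : Type) (d : X -> X -> nat) (D : nat).
Hypothesis (gmX : graph_metric d) (hypD : hyperbolic d D).
Let dxx := gm_refl gmX.
Let dC := gm_sym gmX.
Let dT := gm_triangle gmX.

Definition quasi_geodesic L n (c : nat -> X) :=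
  (forall i, i < n -> d (c i) (c i.+1) <= L) /\
  (forall i j, i <= j -> j <= n -> j - i <= L * d (c i) (c j)).

Lemma quasi_geodesic_lip L n c i j : quasi_geodesic L n c ->
  i <= j -> j <= n -> d (c i) (c j) <= L * (j - i).
Proof.
move=> [st _]; elim: j => [|j IHj]; first by rewrite leqn0 => /eqP ->; rewrite dxx.
rewrite leq_eqVlt => /orP[/eqP -> _|lt_ij lt_jn]; first by rewrite dxx.
have := IHj lt_ij (ltnW lt_jn); have := st j lt_jn; have := dT (c i) (c j) (c j.+1).
by rewrite subSn //; lia.
Qed.

(** Let [r] be the largest distance to the path among points of the geodesic,
    attained at [g t].  Go from [g t] back and forth by [2 r] along the geodesic
    to [y] and [z], then to points [c i] and [c j] of the path closest to these.
    The chain [y, c i, ..., c j, z] avoids the ball of radius [r] about [g t], so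
    its consecutive doubled products based at [g t] are at least [2 r - L], and
    since [d (c i) (c j) <= 6 r] it has at most [6 L r + 2] steps.  But [g t] is
    between [y] and [z], where the product vanishes; hence [2 r] is at most
    logarithmic in [r]. *)
Lemma geodesic_near_path L : exists M, forall n c g,
  quasi_geodesic L n c -> geodesic d (c 0) (c n) g ->
  forall t, t <= d (c 0) (c n) -> exists2 i, i <= n & d (g t) (c i) <= M.
Proof.
have [M hM] := log_bound (6 * L) (L + 2 * D) D.
exists M => n c g qc [g0 gn gE]; set N := d (c 0) (c n) in gn gE *.
pose P r := forall t, t <= N -> exists2 i, i <= n & d (g t) (c i) <= r.
have [r Pr minr] : exists2 r, P r & forall s, s < r -> ~ P s.
  have [r0] : exists r, P r.
    by exists N => t tN; exists 0 => //; rewrite -g0 dC gE ?subn0.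
  elim/ltn_ind: r0 => r IH Pr.
  have [[s [lts Ps]]|no] := EM (exists s, s < r /\ P s).
    exact: IH lts Ps.
  by exists r => // s lts Ps; apply: no; exists s.
suff le_rM : r <= M.
  by move=> t /Pr [i ilen le]; exists i => //; apply: leq_trans le_rM.
case: r Pr minr => // r0 Pr minr; set r := r0.+1 in Pr *.
have [t [tN far]] : exists t, t <= N /\ forall i, i <= n -> r <= d (g t) (c i).
  apply: contrapT => no; apply: (minr r0 (ltnSn _)) => t tN.
  apply: contrapT => no2; apply: no; exists t; split=> // i ilen.
  by rewrite /r ltnNge; apply/negP => le; apply: no2; exists i.
(* Near the ends of the geodesic [y] or [z] is an endpoint, lying on the path. *)
have [i [ilen yi gyi]] : exists i, [/\ i <= n, d (g (t - 2 * r)) (c i) <= r &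
    2 * r <= gromov2 d (g t) (g (t - 2 * r)) (c i)].
  have [le|lt] := leqP (2 * r) t.
    have [i ilen yi] := Pr (t - 2 * r) ltac:(lia).
    exists i; split=> //; have := far i ilen; rewrite /gromov2 gE ?(dC (c i)); lia.
  exists 0; have -> : t - 2 * r = 0 by lia.
  by rewrite g0 dxx; split=> //; have := far 0; rewrite /gromov2 dxx (dC (c 0)); lia.
have [j [jlen zj gzj]] : exists j, [/\ j <= n, d (g (minn N (t + 2 * r))) (c j) <= r &
    2 * r <= gromov2 d (g t) (g (minn N (t + 2 * r))) (c j)].
  have [le|lt] := leqP (t + 2 * r) N.
    have [j jlen zj] := Pr (t + 2 * r) le.
    exists j; split=> //.
    by have := far j jlen; rewrite /gromov2 (dC (g (t + _))) gE ?(dC (c j)); lia.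
  exists n; rewrite gn dxx; split=> //.
  by have := far n; rewrite /gromov2 dxx (dC (c n)); lia.
set y := g _ in yi gyi; set z := g _ in zj gzj.
have yt : d y (g t) <= 2 * r by rewrite /y gE; lia.
have zt : d (g t) z <= 2 * r by rewrite /z gE; lia.
have yz : gromov2 d (g t) y z = 0 by rewrite /gromov2 /y /z (dC (g (minn _ _))) !gE; lia.
have cij : d (c i) (c j) <= 6 * r.
  have := dT (c i) y (c j); have := dT y (g t) (c j); have := dT (g t) z (c j).
  by rewrite (dC (c i) y); lia.
apply: hM => k le_k.
have step l : l < n -> 2 * r - L <= gromov2 d (g t) (c l) (c l.+1).
  move=> ln; have := far l (ltnW ln); have := far l.+1 ln; have := qc.1 l ln.
  by rewrite /gromov2 (dC (c l) (g t)) (dC (c l.+1) (g t)); lia.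
have pt l : l <= n -> 2 * r - L <= 2 * d (c l) (g t).
  by move=> ln; have := far l ln; rewrite dC; lia.
have hc : 2 * r - L <= gromov2 d (g t) (c i) (c j) + k * D.
  have [leij|/ltnW leji] := leqP i j.
    apply: (chain_gromov2 gmX hypD ilen jlen) => //.
    by have := qc.2 i j leij jlen; nia.
  rewrite gromov2C //; apply: (chain_gromov2 gmX hypD jlen ilen) => //.
  by have := qc.2 j i leji ilen; rewrite dC; nia.
have := hypD (g t) y (c i) (c j); have := hypD (g t) y (c j) z.
rewrite (gromov2C gmX _ (c j) z) yz; lia.
Qed.

(** The geodesic starts near [c 0] and ends near [c n], and each of its points is
    near some [c j] with [j <= i] or some [c k] with [i <= k].  At the transition
    both hold at once, and then [c j] and [c k], hence [c j], [c i] and [c k],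
    are close to each other and to the geodesic. *)
Lemma path_near_geodesic L : exists M, forall n c,
  quasi_geodesic L n c -> forall i, i <= n -> gromov2 d (c i) (c 0) (c n) <= M.
Proof.
have [M hM] := geodesic_near_path L.
exists (2 * (M + L * (L * (2 * M + 1)))) => n c qc i ilen.
have [g gg] := gm_geodesic gmX (c 0) (c n); have [g0 gn gE] := gg.
set N := d (c 0) (c n) in gn gE.
have [t [tN [j jlei] tj]] : exists t, [/\ t <= N,
    exists2 j, j <= i & d (g t) (c j) <= M &
    exists2 k, i <= k <= n & d (g t) (c k) <= M + 1].
  pose Q t := exists2 j, j <= i & d (g t) (c j) <= M.
  have Q0 : Q 0 by exists 0 => //; rewrite g0 dxx.
  have [QN|nQN] := EM (Q N).
    by exists N; split=> //; exists n; rewrite ?ilen ?leqnn ?gn ?dxx.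
  have [t [tN Qt nQt]] : exists t, [/\ t < N, Q t & ~ Q t.+1].
    apply: contrapT => no; apply: nQN; suff : forall t, t <= N -> Q t by apply.
    elim=> // t IHt tN; apply: contrapT => nQ; apply: no; exists t.
    by split=> //; apply: IHt; apply: ltnW.
  exists t; split=> //; first exact: ltnW.
  have [k klen tk] := hM n c g qc gg t.+1 tN.
  exists k.
    rewrite klen andbT leqNgt; apply/negP => lt.
    by apply: nQt; exists k => //; apply: ltnW.
  have := dT (g t) (g t.+1) (c k).
  have -> : d (g t) (g t.+1) = 1 by rewrite gE // subSnn.
  by lia.
move=> [k /andP[ilek klen] tk].
have cjk : d (c j) (c k) <= 2 * M + 1.
  by have := dT (c j) (g t) (c k); rewrite (dC (c j) (g t)); lia.
have jk := qc.2 j k (leq_trans jlei ilek) klen.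
have cji := quasi_geodesic_lip qc jlei ilen.
have btw : between d (c 0) (g t) (c n).
  by rewrite /between (geodesicL gg tN) (geodesicR gg tN) -/N; lia.
apply: leq_trans (gromov2_between gmX _ btw) _.
have := dT (c i) (c j) (g t); rewrite (dC (c i) (c j)) (dC (c j) (g t)).
have : L * (i - j) <= L * (L * (2 * M + 1)).
  by rewrite leq_mul2l; apply/orP; right; apply: leq_trans (_ : k - j <= _); [lia|nia].
by lia.
Qed.
End Morse.

(** * Bilipschitz embeddings *)

Section Embedding.
Variables (X Y : Type) (dX : X -> X -> nat) (dY : Y -> Y -> nat).
Variables (f : Y -> X) (L : nat).
Hypotheses (gmX : graph_metric dX) (gmY : graph_metric dY).
Hypothesis f_lip : forall x y, dX (f x) (f y) <= L * dY x y.
Hypothesis f_colip : forall x y, dY x y <= L * dX (f x) (f y).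

(** Let [p] be the point of a geodesic from [w] to [y] at distance
    [(x | y)_w] or less, and [(y | z)_w] or less, from [w].  Slimness gives [q]
    near [p] either on the side [w, x], or on [x, y], and in the latter case
    [d w q >= (x | y)_w] forces [p] to be nearly between [w] and [x] again.  The
    same holds for [z], and a detour through [p] then bounds [d x z] from above. *)
Lemma slim_hyperbolic M :
  (forall x y z p, between dY x p y -> exists2 q, dY p q <= M &
     between dY x q z \/ between dY z q y) -> hyperbolic dY (4 * M + 2).
Proof.
move=> slim w x y z; set m := minn _ _.
have [g gg] := gm_geodesic gmY w y.
have dC := gm_sym gmY; have dT := gm_triangle gmY.
have tm : m./2 <= dY w y.
  by have := dT x y w; have := dT y w z; rewrite /m /gromov2 (dC w y); lia.
have wp := geodesicL gg tm; have py := geodesicR gg tm.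
set p := g _ in wp py.
have key u : m <= gromov2 dY w u y -> dY w p + dY p u <= dY w u + 2 * M.
  move=> mu; have [|q pq] := slim w y u p; first by rewrite /between; lia.
  rewrite /between; move: mu; rewrite /gromov2 (dC u w) (dC y w) (dC u y) (dC u q).
  have := dT w p q; have := dT w q p; have := dT p q u; have := dT y q p.
  have := dT p q y; have := dT y w u; rewrite (dC y w).
  rewrite (dC q p) (dC y q) (dC y p).
  lia.
have kx := key x ltac:(rewrite /m; lia).
have kz := key z ltac:(rewrite /m (gromov2C gmY _ y z); lia).
have := dT x p z; rewrite /gromov2 (dC x p) (dC x w) (dC z w); lia.
Qed.

Variables (D : nat) (hypX : hyperbolic dX D).

Lemma image_geodesic x y g : geodesic dY x y g ->
  quasi_geodesic dX L (dY x y) (f \o g).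
Proof.
move=> [_ _ gE]; split=> [i lti|i j leij lej] /=.
  by have := f_lip (g i) (g i.+1); rewrite gE // subSnn muln1.
by rewrite -gE.
Qed.

Lemma between_image : exists M, forall x y p,
  between dY x p y -> gromov2 dX (f p) (f x) (f y) <= M.
Proof.
have [M hM] := path_near_geodesic gmX hypX L.
exists M => x y p btw; have [g gg g_p] := geodesic_through gmY btw.
have lexp : dY x p <= dY x y by rewrite -btw leq_addr.
have := hM _ _ (image_geodesic gg) (dY x p) lexp.
by case: gg => g0 gn _; rewrite /= g_p g0 gn.
Qed.

(** [f w] is near a geodesic of [X] joining the images of [x] and [y], which is
    itself near the image of a geodesic of [Y]; pull back with [f_colip]. *)
Lemma gromov2_image_reflects K : exists M, forall w x y,
  gromov2 dX (f w) (f x) (f y) <= K ->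
  exists2 p, between dY x p y & dY w p <= M.
Proof.
have [M hM] := geodesic_near_path gmX hypX L.
exists (L * (K + D + M)) => w x y le.
have [a [btw wa]] := near_between gmX hypX le.
have [g gg] := gm_geodesic gmY x y; have [g0 gn _] := gg.
have [h gh ha] := geodesic_through gmX btw.
have qg := image_geodesic gg.
have [||i ilen] := hM _ _ h qg _ (dX (f x) a); rewrite /= ?g0 ?gn //.
  by rewrite -btw leq_addr.
rewrite ha => ai; exists (g i).
  by rewrite /between (geodesicL gg ilen) (geodesicR gg ilen); lia.
apply: leq_trans (f_colip _ _) _; rewrite leq_mul2l; apply/orP; right.
by have := gm_triangle gmX (f w) a (f (g i)); lia.
Qed.

(** Geodesic triangles of [Y] are slim: the image of a point between [x] and [y]
    has small product, by the four-point condition in [X] it then has small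
    product with respect to one of the two other pairs, and this pulls back. *)
Lemma embedding_hyperbolic : exists D', hyperbolic dY D'.
Proof.
have [M hM] := between_image; have [M' hM'] := gromov2_image_reflects (M + D).
exists (4 * M' + 2); apply: slim_hyperbolic => x y z p btw.
have le := hM _ _ _ btw; have := hypX (f p) (f x) (f z) (f y).
have [lexz _|ltxz leq] := leqP (gromov2 dX (f p) (f x) (f z)) (M + D).
  by have [q] := hM' p x z lexz; exists q => //; left.
have [|q] := hM' p z y; first by lia.
by exists q => //; right.
Qed.

Lemma gromov2_image_proper K : exists M, forall w x y,
  gromov2 dX (f w) (f x) (f y) <= K -> gromov2 dY w x y <= M.
Proof.
have [M hM] := gromov2_image_reflects K; exists (2 * M) => w x y /hM[p btw wp].
by apply: leq_trans (gromov2_between gmY _ btw) _; rewrite leq_mul2l.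
Qed.

Lemma gromov2_image_bounded K : exists M, forall w x y,
  gromov2 dY w x y <= K -> gromov2 dX (f w) (f x) (f y) <= M.
Proof.
have [D' hypY] := embedding_hyperbolic; have [M hM] := between_image.
exists (M + 2 * (L * (K + D'))) => w x y le.
have [p [btw wp]] := near_between gmY hypY le.
apply: leq_trans (gromov2_move gmX (f w) (f p) _ _) _.
have := hM _ _ _ btw; have := f_lip w p.
have : L * dY w p <= L * (K + D') by rewrite leq_mul2l wp orbT.
by lia.
Qed.

End Embedding.

(** * Word metrics *)

Section Words.
Context {G : groupType}.
Implicit Types (S : seq G) (g h x y : G).
Local Open Scope group_scope.

Definition letters S := S ++ [seq s^-1 | s <- S].

Lemma lettersV S s : s \in letters S -> s^-1 \in letters S.
Proof.
rewrite !mem_cat => /orP[sS|/mapP[t tS ->]]; last by rewrite invgK tS.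
by rewrite map_f ?orbT.
Qed.

Lemma word_of_size_prod S (v : seq G) : {subset v <= letters S} ->
  word_of_size S (\prod_(s <- v) s) (size v).
Proof. by exists v. Qed.

Lemma word_of_sizeM S g h m n : word_of_size S g m -> word_of_size S h n ->
  word_of_size S (g * h) (m + n).
Proof.
move=> [v vS [<- <-]] [w wS [<- <-]]; rewrite -size_cat -big_cat.
by apply: word_of_size_prod => s; rewrite mem_cat => /orP[/vS|/wS].
Qed.

Lemma word_of_sizeV S g n : word_of_size S g n -> word_of_size S g^-1 n.
Proof.
move=> [v vS [<- <-]]; rewrite -{1}[v]revK -prodgV.
rewrite -(big_map (fun s => s^-1) xpredT id) -size_rev.
rewrite -(size_map (fun s => s^-1)); apply: word_of_size_prod => s /mapP[t].
by rewrite mem_rev => /vS tS ->; apply: lettersV.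
Qed.

Lemma word_lengthP S g n : word_of_size S g n ->
  word_of_size S g (word_length S g) /\ word_length S g <= n.
Proof.
elim/ltn_ind: n => n IH wn.
have [[k [kn wk]]|no] := EM (exists k, k < n /\ word_of_size S g k).
  by have [? /leq_trans le] := IH k kn wk; split=> //; apply: le; apply: ltnW.
rewrite /word_length; case: xgetP => [k -> /= [wk mink]|/(_ n)[]].
  by split=> //; apply: mink.
by split=> // k wk; rewrite leqNgt; apply/negP => kn; apply: no; exists k.
Qed.

Lemma word_length_le S g n : word_of_size S g n -> word_length S g <= n.
Proof. by move=> /word_lengthP[]. Qed.

Section Generates.
Variables (S : seq G) (genS : generates S).

Lemma word_of_length g : word_of_size S g (word_length S g).
Proof. by have [n /word_lengthP[]] := genS g. Qed.

Lemma word_length1 : word_length S 1 = 0.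
Proof.
apply/eqP; rewrite -leqn0; apply: word_length_le.
by exists [::] => //; rewrite big_nil.
Qed.

Lemma word_lengthM g h :
  word_length S (g * h) <= word_length S g + word_length S h.
Proof. by apply/word_length_le/word_of_sizeM; apply: word_of_length. Qed.

Lemma word_lengthV g : word_length S g^-1 = word_length S g.
Proof.
have le h : word_length S h^-1 <= word_length S h.
  by apply/word_length_le/word_of_sizeV/word_of_length.
by apply/eqP; rewrite eqn_leq le -{1}[g]invgK le.
Qed.

Lemma word_dist1 g : word_dist S 1 g = word_length S g.
Proof. by rewrite /word_dist invg1 mul1g. Qed.

Lemma word_dist_sym x y : word_dist S x y = word_dist S y x.
Proof. by rewrite /word_dist -word_lengthV invgM invgK. Qed.

Lemma word_dist_triangle x y z :
  word_dist S x z <= word_dist S x y + word_dist S y z.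
Proof.
rewrite /word_dist; apply: leq_trans (word_lengthM _ _).
by rewrite -mulgA mulVKg.
Qed.

(** The prefixes of a shortest word for [x^-1 * y] form a geodesic: each subword
    bounds a distance from above, and the triangle inequality from below. *)
Lemma word_dist_graph_metric : graph_metric (word_dist S).
Proof.
have dxx x : word_dist S x x = 0 by rewrite /word_dist mulVg word_length1.
split=> //; [exact: word_dist_sym|exact: word_dist_triangle|move=> x y].
have [v vS [vn vxy]] := word_of_length (x^-1 * y).
rewrite -/(word_dist S x y) in vn.
pose g i := x * \prod_(s <- take i v) s.
have gn : g (word_dist S x y) = y by rewrite /g -vn take_size vxy mulVKg.
have g0 : g 0 = x by rewrite /g take0 big_nil mulg1.
have gle i j : i <= j -> j <= word_dist S x y -> word_dist S (g i) (g j) <= j - i.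
  move=> leij lej; rewrite /word_dist /g -[take j v](cat_take_drop i).
  rewrite -take_min (minn_idPl leij) big_cat /= invgM -!mulgA mulKg mulKg.
  have -> : j - i = size (drop i (take j v)) by rewrite size_drop size_takel ?vn.
  apply/word_length_le/word_of_size_prod => s /mem_drop/mem_take; exact: vS.
exists g; split=> // i j leij lej; apply/eqP; rewrite eqn_leq gle //=.
have := gle 0 i (leq0n _) (leq_trans leij lej); have := gle j _ lej (leqnn _).
rewrite g0 gn.
have := word_dist_triangle x (g i) y; have := word_dist_triangle (g i) (g j) y.
lia.
Qed.

Lemma finite_ball n : exists B : seq G, forall g, word_length S g <= n -> g \in B.
Proof.
suff [B hB] : exists B : seq G, forall g m, m <= n -> word_of_size S g m -> g \in B.
  by exists B => g gn; apply: hB gn (word_of_length g).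
elim: n => [|n [B hB]].
  exists [:: 1] => g [|//] _ [v _ [/size0nil -> <-]].
  by rewrite big_nil mem_head.
exists (B ++ [seq s * g | s <- letters S, g <- B]) => g m mn [v vS [vm vg]].
rewrite mem_cat; apply/orP; case: v vS vm vg => [|s v] vS vm vg.
  by left; apply: (hB _ 0) => //; exists [::].
right; apply/allpairsP; exists (s, \prod_(t <- v) t); rewrite /= -vg big_cons.
split=> //; first by apply: vS; rewrite mem_head.
apply: (hB _ (size v)); first by rewrite -ltnS (leq_trans _ mn) // -vm.
by apply: word_of_size_prod => t tv; apply: vS; rewrite inE tv orbT.
Qed.

End Generates.
End Words.

Lemma word_dist_morphism (G H : groupType) (f : UMagmaMorphism.type G H) S T :
  generates S -> generates T ->
  exists L, forall x y, word_dist T (f x) (f y) <= L * word_dist S x y.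
Proof.
move=> genS genT; exists (\sum_(s <- S) word_length T (f s)) => x y.
rewrite /word_dist -gmulfV -gmulfM.
have [v vS [vn vg]] := word_of_length genS (x^-1 * y)%g.
rewrite -vn -vg; elim: v vS {vn vg} => [|s v IHv] vS.
  by rewrite big_nil gmulf1 word_length1.
rewrite big_cons gmulfM /= mulnS; apply: leq_trans (word_lengthM genT _ _) _.
apply: leq_add; last by apply: IHv => t tv; apply: vS; rewrite inE tv orbT.
have : s \in letters S by apply: vS; rewrite mem_head.
have le t : t \in S -> word_length T (f t) <= \sum_(s <- S) word_length T (f s).
  by move=> tS; rewrite (big_rem t) //= leq_addr.
rewrite mem_cat => /orP[/le //|/mapP[t tS ->]].
by rewrite gmulfV (word_lengthV genT) le.
Qed.

Section Invariant.
Variables (G : groupType) (sigma : UMagmaMorphism.type G G) (m : nat).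
Hypotheses (m_gt0 : 0 < m) (sigma_m : iter m sigma =1 id).

(** The sigma-invariant generating set for which sigma is an isometry. *)
Definition orbit_seq (S : seq G) : seq G :=
  flatten [seq map (iter k sigma) S | k <- iota 0 m].

Lemma orbit_seqP S g : reflect (exists k s, [/\ k < m, s \in S & g = iter k sigma s])
  (g \in orbit_seq S).
Proof.
apply: (iffP flatten_mapP) => [[k]|[k [s [km sS ->]]]].
  by rewrite mem_iota => km /mapP[s sS ->]; exists k, s.
by exists k; [rewrite mem_iota | apply: map_f].
Qed.

Lemma generates_sub S S' : {subset S <= S'} -> generates S -> @generates G S'.
Proof.
move=> sub gen g; have [n [v vS vg]] := gen g; exists n, v => // s /vS.
rewrite !mem_cat => /orP[/sub -> //|/mapP[t /sub tS ->]].
by rewrite map_f ?orbT.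
Qed.

Lemma orbit_seq_generates S : generates S -> generates (orbit_seq S).
Proof.
by apply: generates_sub => s sS; apply/orbit_seqP; exists 0, s.
Qed.

Lemma orbit_seq_stable S s : s \in orbit_seq S -> sigma s \in orbit_seq S.
Proof.
move=> /orbit_seqP[k [t [km tS ->]]]; apply/orbit_seqP.
have [lt|le] := ltnP k.+1 m; first by exists k.+1, t.
by exists 0, t; split=> //; rewrite -iterS; have -> : k.+1 = m; [lia|apply: sigma_m].
Qed.

(** sigma maps words to words of the same size, so it does not increase lengths;
    neither does its inverse, which is a power of sigma. *)
Lemma orbit_seq_isometry S : generates S ->
  forall x y, word_dist (orbit_seq S) (sigma x) (sigma y) = word_dist (orbit_seq S) x y.
Proof.
move=> gen x y; have gen' := orbit_seq_generates gen.
rewrite /word_dist -gmulfV -gmulfM; set g := (_ * _)%g.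
have le h : word_length (orbit_seq S) (sigma h) <= word_length (orbit_seq S) h.
  apply: word_length_le; have [v vS [vn vh]] := word_of_length gen' h.
  rewrite -vn -vh gmulf_prod -(big_map _ xpredT id) -(size_map sigma).
  apply: word_of_size_prod => s /mapP[t /vS tS ->]; move: tS.
  rewrite !mem_cat => /orP[/orbit_seq_stable -> //|/mapP[u /orbit_seq_stable uS ->]].
  by rewrite gmulfV map_f ?orbT.
apply/eqP; rewrite eqn_leq le /= -{1}[g]sigma_m -(prednK m_gt0) iterSr.
by elim: (m.-1) (sigma g) => //= k IHk h; apply: leq_trans (le _) (IHk h).
Qed.
End Invariant.

Section HalfIntegers.
Variables (G : groupType) (S : seq G).
Hypothesis genS : generates S.
Let gm := word_dist_graph_metric genS.
Local Open Scope ring_scope.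

Lemma gromov_productE w x y :
  gromov_product S w x y = (gromov2 (word_dist S) w x y)%:R / 2.
Proof.
rewrite /gromov_product /gromov2 natrB ?natrD //.
by rewrite (gm_sym gm y w); apply: gm_triangle.
Qed.

Lemma min_half (a b : nat) :
  Num.min (a%:R / 2) (b%:R / 2) = (minn a b)%:R / 2 :> rat.
Proof.
by case: (leqP a b) => [le|/ltnW le]; [apply: min_l|apply: min_r];
  rewrite ler_pM2r ?ler_nat.
Qed.

Lemma hyperbolic_wrtP : hyperbolic_wrt S <-> exists D, hyperbolic (word_dist S) D.
Proof.
split=> [[delta hyp]|[D hyp]].
  have [D hD] : exists D : nat, 2 * delta <= D%:R.
    by exists (Num.truncn (2 * delta)).+1; apply/ltW/truncnS_gt.
  exists D => w x y z; have := hyp w x y z; rewrite !gromov_productE min_half.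
  by rewrite -(ler_nat rat) natrD => h; lra.
exists (D%:R / 2) => w x y z; have := hyp w x y z; rewrite !gromov_productE min_half.
by rewrite -(ler_nat rat) natrD => h; lra.
Qed.
End HalfIntegers.

Lemma uniform_bound (T : eqType) (B : seq T) (P : T -> nat -> Prop) :
  (forall u m n, m <= n -> P u m -> P u n) ->
  (forall u, u \in B -> exists n, P u n) ->
  exists N, forall u, u \in B -> P u N.
Proof.
move=> mono; elim: B => [|u B IH] ex; first by exists 0.
have [|N hN] := IH; first by move=> v vB; apply: ex; rewrite inE vB orbT.
have [n hn] := ex u (mem_head _ _).
exists (maxn n N) => v; rewrite inE => /orP[/eqP ->|/hN].
  by apply: mono hn; apply: leq_maxl.
by apply: mono; apply: leq_maxr.
Qed.

(** * The fixed subgroup is undistorted *)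

Section FixedVal.
Variables (G : groupType) (sigma : UMagmaMorphism.type G G).

(** The inclusion of the fixed subgroup, under a name of its own that carries its
    structure of group morphism. *)
Definition fixed_val (h : fixed_subgroup sigma) : G := sval h.

Lemma fixed_val_inj : injective fixed_val.
Proof. exact: val_inj. Qed.

Lemma sigma_fixed_val h : sigma (fixed_val h) = fixed_val h.
Proof. exact: eqP (valP h). Qed.

Fact fixed_valM : {morph fixed_val : x y / (x * y)%g}.
Proof. exact: (@gmulfM _ _ (val : fixed_subgroup sigma -> G)). Qed.
HB.instance Definition _ := isMultiplicative.Build _ _ fixed_val fixed_valM.

Fact fixed_val1 : fixed_val 1%g = 1%g.
Proof. exact: (@gmulf1 _ _ (val : fixed_subgroup sigma -> G)). Qed.
HB.instance Definition _ := Multiplicative_isUMagmaMorphism.Build _ _ fixed_val fixed_val1.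

End FixedVal.

Section FixedPoints.
Variables (G : groupType) (sigma : UMagmaMorphism.type G G) (S : seq G) (D : nat).
Hypotheses (genS : generates S) (hypS : hyperbolic (word_dist S) D).
Hypothesis sigma_isometry :
  forall x y, word_dist S (sigma x) (sigma y) = word_dist S x y.
Let d := word_dist S.
Let gm : graph_metric d := word_dist_graph_metric genS.

(** If [y] and [z] have the same displacement [y^-1 * sigma y = z^-1 * sigma z]
    then [y * z^-1] is fixed.  Only finitely many displacements have length at
    most [K], so [z] can be chosen of bounded length. *)
Lemma almost_fixed K : exists R, forall y, d y (sigma y) <= K ->
  exists h : fixed_subgroup sigma, d y (fixed_val h) <= R.
Proof.
have [B hB] := finite_ball genS K.
have [||R hR] := @uniform_bound _ B (fun u n => forall y, (y^-1 * sigma y)%g = u ->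
    exists2 z, (z^-1 * sigma z)%g = u & word_length S z <= n).
- by move=> u m n mn h y /h[z zu zm]; exists z => //; apply: leq_trans mn.
- move=> u _; have [[y yu]|no] := EM (exists y, (y^-1 * sigma y)%g = u).
    by exists (word_length S y) => _ _; exists y.
  by exists 0 => y yu; case: no; exists y.
exists R => y yK; have [z zy zR] := hR _ (hB _ yK) y erefl.
have fix_h : (y * z^-1)%g \in fixed_pred sigma.
  rewrite inE gmulfF; apply/eqP.
  have -> : sigma y = (y * z^-1 * sigma z)%g by rewrite -mulgA zy mulVKg.
  by rewrite mulgK.
exists (Sub (y * z^-1)%g fix_h); rewrite /d /word_dist /fixed_val /= mulgA mulVg mul1g.
by rewrite word_lengthV.
Qed.

(** [g t] and [sigma (g t)] are at distance [t] from 1 on geodesics to [x] and to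
    [sigma x]; two uses of the four-point condition, through [x] and [sigma x],
    give [(g t | sigma (g t))_1 >= t - D]. *)
Lemma displacement_bound x g t : geodesic d 1%g x g ->
  2 * t <= gromov2 d 1%g x (sigma x) -> t <= d 1%g x /\ d (g t) (sigma (g t)) <= 2 * D.
Proof.
move=> gg le; have dC := gm_sym gm; have dT := gm_triangle gm.
have s1 : sigma 1%g = 1%g := gmulf1.
have d1 y : d 1%g (sigma y) = d 1%g y by rewrite -[in LHS]s1; apply: sigma_isometry.
have tx : t <= d 1%g x.
  by move: le; have := dT 1%g x (sigma x); rewrite /gromov2 !(dC _ 1%g) d1; lia.
split=> //; have e1 := geodesicL gg tx; have e2 := geodesicR gg tx.
have e3 : d (sigma (g t)) (sigma x) = d 1%g x - t by rewrite -e2; apply: sigma_isometry.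
have h1 := hypS 1%g (g t) x (sigma x).
have h2 := hypS 1%g (g t) (sigma x) (sigma (g t)).
move: le h1 h2; rewrite -/d /gromov2 !(dC _ 1%g) !d1 e1 e2 (dC (sigma x) (sigma _)) e3.
by have := dT (g t) 1%g (sigma (g t)); rewrite (dC _ 1%g) d1 e1; lia.
Qed.

Lemma fixed_near_geodesic : exists R, forall x g t, geodesic d 1%g x g ->
  2 * t <= gromov2 d 1%g x (sigma x) ->
  exists h : fixed_subgroup sigma, d (g t) (fixed_val h) <= R.
Proof.
have [R hR] := almost_fixed (2 * D).
by exists R => x g t gg /(displacement_bound gg)[_ /hR].
Qed.

(** Shadow the geodesic from 1 to [h] by elements of the fixed subgroup; two
    consecutive shadows differ by an element of length at most [2 R + 1].  The
    induction is on all elements [k] close to [g i], so that it ends with [h]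
    itself. *)
Lemma fixed_subgroup_undistorted : exists2 T : seq (fixed_subgroup sigma),
  generates T &
  exists L, forall x y, word_dist T x y <= L * d (fixed_val x) (fixed_val y).
Proof.
have dC := gm_sym gm; have dT := gm_triangle gm.
have [R hR] := fixed_near_geodesic; have [B hB] := finite_ball genS (2 * R + 1).
pose T : seq (fixed_subgroup sigma) := pmap insub B.
have hT k : word_length S (fixed_val k) <= 2 * R + 1 -> word_of_size T k 1.
  move=> /hB kB; exists [:: k]; last by rewrite big_seq1.
  by move=> _ /[!inE]/eqP ->; rewrite mem_cat mem_pmap_sub kB.
have key (h : fixed_subgroup sigma) : word_of_size T h (word_length S (fixed_val h)).+1.
  have [g gg] := gm_geodesic gm 1%g (fixed_val h); have [g0 gn gE] := gg.
  have n_h : d 1%g (fixed_val h) = word_length S (fixed_val h) by apply: word_dist1.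
  suff claim i : i <= d 1%g (fixed_val h) ->
      forall k : fixed_subgroup sigma, d (g i) (fixed_val k) <= R -> word_of_size T k i.+1.
    by rewrite -n_h; apply: claim => //; rewrite gn (gm_refl gm).
  elim: i => [|i IHi] lei k.
    by rewrite g0 /d word_dist1 => kR; apply: hT; lia.
  move=> kR; have [|h' h'R] := hR (fixed_val h) g i gg.
    by rewrite sigma_fixed_val /gromov2 (dC (fixed_val h) 1%g) (gm_refl gm); lia.
  rewrite -[k](mulVKg h') -addn1; apply: word_of_sizeM.
    exact: IHi (ltnW lei) _ h'R.
  apply: hT; rewrite gmulfM gmulfV /= -/(word_dist S (fixed_val h') (fixed_val k)) -/d.
  have := dT (fixed_val h') (g i) (fixed_val k); have := dT (g i) (g i.+1) (fixed_val k).
  by rewrite (gE i i.+1) // subSnn (dC (fixed_val h') (g i)); lia.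
exists T; first by move=> h; eexists; apply: key.
(* The factor 2 absorbs the additive 1 in [key] for nontrivial elements. *)
exists 2 => x y; rewrite {1}/word_dist; set h := (_ * _)%g.
have hE : d (fixed_val x) (fixed_val y) = word_length S (fixed_val h).
  by rewrite gmulfM gmulfV.
rewrite hE; have [h0|] := posnP (word_length S (fixed_val h)).
  have : fixed_val h = 1%g.
    by apply/esym/(dist0_eq gm); rewrite /d word_dist1.
  rewrite -(@fixed_val1 _ sigma) => /fixed_val_inj ->.
  by rewrite word_length1.
by have := word_length_le (key h); lia.
Qed.

End FixedPoints.

(** * Boundary points as classes of sequences *)

Section Sequences.
Variables (G : groupType) (S : seq G).
Implicit Types x y z : nat -> G.

Definition gromov2_eventually x y n := exists N, forall i j, N <= i -> N <= j ->
  n <= gromov2 (word_dist S) 1%g (x i) (y j).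

Definition gromov2_diverges x y := forall n, gromov2_eventually x y n.

Hypothesis genS : generates S.
Let gm := word_dist_graph_metric genS.

Lemma eventually_geP x y n :
  eventually_ge S x y (n%:R / 2)%R <-> gromov2_eventually x y n.
Proof.
split=> -[N hN]; exists N => i j Ni Nj; have := hN i j Ni Nj;
  by rewrite (gromov_productE genS) ler_pM2r ?ler_nat.
Qed.

Lemma eventually_geW x y r s : (r <= s)%R ->
  eventually_ge S x y s -> eventually_ge S x y r.
Proof.
by move=> rs [N hN]; exists N => i j Ni Nj; apply: le_trans rs (hN i j Ni Nj).
Qed.

Lemma rat_le_half (r : rat) : exists n : nat, (r <= n%:R / 2)%R.
Proof.
exists (Num.truncn (2 * r)%R).+1; have := truncnS_gt (2 * r)%R; lra.
Qed.

Lemma gromov_equivP x y : gromov_equiv S x y <-> gromov2_diverges x y.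
Proof.
split=> [xy n|xy r]; first exact/eventually_geP.
have [n rn] := rat_le_half r; apply: eventually_geW rn _; exact/eventually_geP.
Qed.

Lemma gromov2_eventuallyC x y n :
  gromov2_eventually x y n -> gromov2_eventually y x n.
Proof. by move=> [N hN]; exists N => i j Ni Nj; rewrite (gromov2C gm); apply: hN. Qed.

Lemma gromov2_eventuallyW x y m n : m <= n ->
  gromov2_eventually x y n -> gromov2_eventually x y m.
Proof. by move=> mn [N hN]; exists N => i j Ni Nj; apply: leq_trans mn (hN i j Ni Nj). Qed.

Variables (D : nat) (hypS : hyperbolic (word_dist S) D).

(** A single late term of [y] serves as the middle point for all [i] and [j]. *)
Lemma gromov2_eventually_trans x y z n : gromov2_eventually x y (n + D) ->
  gromov2_eventually y z (n + D) -> gromov2_eventually x z n.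
Proof.
move=> [N hN] [M hM]; exists (maxn N M) => i j Ni Mj; set k := maxn N M.
have := hypS 1%g (x i) (y k) (z j).
have := hN i k ltac:(lia) ltac:(lia); have := hM k j ltac:(lia) ltac:(lia); lia.
Qed.

Lemma gromov2_diverges_trans x y z :
  gromov2_diverges x y -> gromov2_diverges y z -> gromov2_diverges x z.
Proof. by move=> xy yz n; apply: gromov2_eventually_trans (xy _) (yz _). Qed.

Lemma gromov2_divergesC x y : gromov2_diverges x y -> gromov2_diverges y x.
Proof. by move=> xy n; apply: gromov2_eventuallyC. Qed.

Lemma gromov2_diverges_refl x y : gromov2_diverges x y -> gromov2_diverges x x.
Proof. by move=> xy; apply: gromov2_diverges_trans xy (gromov2_divergesC xy). Qed.

Implicit Types p q : boundary S.

Lemma boundary_nonempty p : exists x, sval p x.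
Proof. by case: p => P [x sx PE]; exists x => /=; rewrite PE. Qed.

Lemma boundary_memP p x y : sval p x -> sval p y <-> gromov2_diverges x y.
Proof.
case: p => P [z sz PE] /=; rewrite PE => -[/gromov_equivP sx /gromov_equivP zx]; split.
  move=> [_ /gromov_equivP zy]; exact: gromov2_diverges_trans (gromov2_divergesC zx) zy.
move=> xy; split; apply/gromov_equivP; last exact: gromov2_diverges_trans zx xy.
exact: gromov2_diverges_refl (gromov2_divergesC xy).
Qed.

Lemma boundary_ext p q x : sval p x -> sval q x -> p = q.
Proof.
move=> px qx; have : sval p = sval q.
  apply/seteqP; split=> y.
    by move/(boundary_memP y px)/(boundary_memP y qx).
  by move/(boundary_memP y qx)/(boundary_memP y px).
by case: p q {px qx} => [P hP] [Q hQ] /=; apply: eq_exist.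
Qed.

Lemma boundary_point x : gromov2_diverges x x -> exists p, sval p x.
Proof.
move=> /gromov_equivP sx.
have h : exists2 z, gromov_sequence S z & gromov_class S x = gromov_class S z.
  by exists x.
by exists (exist _ (gromov_class S x) h).
Qed.

Lemma boundary_ball_mem p q x y n : sval p x -> sval q y ->
  gromov2_eventually x y n -> boundary_ball p (n%:R / 2)%R q.
Proof. by move=> px qy xy; exists x, y; split=> //; apply/eventually_geP. Qed.

(** Membership in a ball is witnessed by some pair of representatives; any other
    pair does as well, at the cost of [D] at each of the two ends. *)
Lemma boundary_ball_eventually p q x y n : sval p x -> sval q y ->
  boundary_ball p ((n + 2 * D)%N%:R / 2)%R q -> gromov2_eventually x y n.
Proof.
move=> px qy [x' [y' [px' qy' /eventually_geP xy]]].
have xx' := (boundary_memP _ px).1 px'; have yy' := (boundary_memP _ qy').1 qy.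
apply: gromov2_eventually_trans (xx' _) _; apply: gromov2_eventually_trans _ (yy' _).
by apply: gromov2_eventuallyW xy; lia.
Qed.

(** The points having some ball contained in the given one form an open set,
    because, in doubled units, the ball of index [n + 3 D] about a point of the
    ball of index [n + 3 D] about [q] lies in the ball of index [n] about [q]. *)
Lemma nbhs_boundary_ball p r : nbhs p (boundary_ball p r).
Proof.
pose U := [set q | exists s, boundary_ball q s `<=` boundary_ball p r]%classic.
have refl q s : boundary_ball q s q.
  have [x qx] := boundary_nonempty q; exists x, x; split=> //.
  by apply: (iffRL (gromov_equivP x x)); apply/(boundary_memP _ qx).
rewrite nbhsE /=; exists U; last by move=> q [s]; apply; apply: refl.
split; last by exists r.
move=> q [s qs]; have [n sn] := rat_le_half s.
exists ((n + D + 2 * D)%N%:R / 2)%R => q' qq'.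
exists ((n + D + 2 * D)%N%:R / 2)%R => q'' q'q''.
apply: qs; apply: (boundary_ballS sn).
have [x qx] := boundary_nonempty q; have [y q'y] := boundary_nonempty q'.
have [z q''z] := boundary_nonempty q''.
apply: (boundary_ball_mem qx q''z); apply: (@gromov2_eventually_trans _ y).
  exact: boundary_ball_eventually qx q'y qq'.
exact: boundary_ball_eventually q'y q''z q'q''.
Qed.

Lemma nbhs_boundaryP p A :
  nbhs p A <-> exists n : nat, (boundary_ball p (n%:R / 2)%R `<=` A)%classic.
Proof.
split=> [|[n nA]].
  rewrite nbhsE /= => -[U [oU Up] UA].
  have [r rU] := oU p Up; have [n rn] := rat_le_half r.
  by exists n => q /(boundary_ballS rn)/rU/UA.
by apply: filterS nA _; apply: nbhs_boundary_ball.
Qed.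

End Sequences.

(** * Change of generators and passage to a subgroup *)

Section Transfer.
Variables (G H : groupType) (f : UMagmaMorphism.type H G) (T : seq H) (S : seq G).
Variables (L D : nat).
Hypotheses (genT : generates T) (genS : generates S).
Hypothesis f_lip : forall x y, word_dist S (f x) (f y) <= L * word_dist T x y.
Hypothesis f_colip : forall x y, word_dist T x y <= L * word_dist S (f x) (f y).
Hypothesis hypS : hyperbolic (word_dist S) D.
Let gmS := word_dist_graph_metric genS.
Let gmT := word_dist_graph_metric genT.

Lemma gromov2_eventually_image n : exists n', forall x y : nat -> H,
  gromov2_eventually T x y n' -> gromov2_eventually S (f \o x) (f \o y) n.
Proof.
have [M hM] := gromov2_image_proper gmS gmT f_lip f_colip hypS n.
exists M.+1 => x y [N hN]; exists N => i j Ni Nj; rewrite leqNgt; apply/negP => lt.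
have := hM 1%g (x i) (y j); rewrite gmulf1 => /(_ (ltnW lt)).
by rewrite leqNgt hN.
Qed.

Lemma gromov2_eventually_reflect n : exists n', forall x y : nat -> H,
  gromov2_eventually S (f \o x) (f \o y) n' -> gromov2_eventually T x y n.
Proof.
have [M hM] := gromov2_image_bounded gmS gmT f_lip f_colip hypS n.
exists M.+1 => x y [N hN]; exists N => i j Ni Nj; rewrite leqNgt; apply/negP => lt.
have := hM 1%g (x i) (y j) (ltnW lt); rewrite gmulf1.
by rewrite leqNgt (hN i j).
Qed.

Lemma gromov2_diverges_image (x y : nat -> H) :
  gromov2_diverges T x y <-> gromov2_diverges S (f \o x) (f \o y).
Proof.
split=> xy n; first by have [n' hn'] := gromov2_eventually_image n; apply: hn'.
by have [n' hn'] := gromov2_eventually_reflect n; apply: hn'.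
Qed.

End Transfer.

Lemma generators_bilipschitz (G : groupType) (S S' : seq G) :
  generates S -> generates S' ->
  exists L, (forall x y, word_dist S' x y <= L * word_dist S x y) /\
            (forall x y, word_dist S x y <= L * word_dist S' x y).
Proof.
move=> genS genS'.
have [L hL] := word_dist_morphism (idfun : UMagmaMorphism.type G G) genS genS'.
have [L' hL'] := word_dist_morphism (idfun : UMagmaMorphism.type G G) genS' genS.
exists (maxn L L'); split=> x y.
  by apply: leq_trans (hL x y) _; rewrite leq_mul2r leq_maxl orbT.
by apply: leq_trans (hL' x y) _; rewrite leq_mul2r leq_maxr orbT.
Qed.

Lemma hyperbolic_generators (G : groupType) (S S' : seq G) D :
  generates S -> generates S' -> hyperbolic (word_dist S) D ->
  exists D', hyperbolic (word_dist S') D'.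
Proof.
move=> genS genS'; have [L [h1 h2]] := generators_bilipschitz genS genS'.
exact: (embedding_hyperbolic (f := idfun) (word_dist_graph_metric genS)
  (word_dist_graph_metric genS') h2 h1).
Qed.

(** * The boundary of the fixed subgroup *)

Section FixedBoundary.
Variables (G : groupType) (sigma : UMagmaMorphism.type G G) (m : nat).
Hypotheses (m_gt0 : 0 < m) (sigma_m : iter m sigma =1 id).
Variables (S : seq G) (D : nat).
Hypotheses (genS : generates S) (hypS : hyperbolic (word_dist S) D).

Let S' := orbit_seq sigma m S.
Let genS' : generates S' := orbit_seq_generates sigma m_gt0 genS.

Lemma orbit_seq_hyperbolic : exists D', hyperbolic (word_dist S') D'.
Proof. exact: hyperbolic_generators genS genS' hypS. Qed.

(** Boundary points for [S] may be studied in the metric of [S'], where sigma is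
    an isometry. *)
Lemma gromov2_diverges_orbit_seq (x y : nat -> G) :
  gromov2_diverges S' x y <-> gromov2_diverges S x y.
Proof.
have [L [h1 h2]] := generators_bilipschitz genS genS'.
exact: (gromov2_diverges_image (f := (idfun : UMagmaMorphism.type G G))
  genS' genS h2 h1 hypS).
Qed.

Lemma gromov2_diverges_sigma (x y : nat -> G) :
  gromov2_diverges S x y -> gromov2_diverges S (sigma \o x) (sigma \o y).
Proof.
move=> /gromov2_diverges_orbit_seq xy; apply/gromov2_diverges_orbit_seq => n.
have iso := orbit_seq_isometry m_gt0 sigma_m genS.
have iso1 z : word_dist S' (sigma z) 1%g = word_dist S' z 1%g.
  by rewrite -[in LHS](gmulf1 (s := sigma)) iso.
have [N hN] := xy n; exists N => i j Ni Nj; have := hN i j Ni Nj.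
by rewrite /gromov2 /= !iso1 iso.
Qed.

Lemma fixed_undistorted (T : seq (fixed_subgroup sigma)) : generates T ->
  exists L, (forall x y, word_dist S (fixed_val x) (fixed_val y) <= L * word_dist T x y) /\
    (forall x y, word_dist T x y <= L * word_dist S (fixed_val x) (fixed_val y)).
Proof.
move=> genT; have [D' hypS'] := orbit_seq_hyperbolic.
have [T0 genT0 [L0 hL0]] := fixed_subgroup_undistorted genS' hypS'
  (orbit_seq_isometry m_gt0 sigma_m genS).
have [L1 hL1] := word_dist_morphism (@fixed_val _ sigma) genT genS.
have [L2 [hL2 _]] := generators_bilipschitz genT0 genT.
have [L3 [hL3 _]] := generators_bilipschitz genS genS'.
exists (maxn L1 (L2 * (L0 * L3))); split=> x y.
  by apply: leq_trans (hL1 x y) _; rewrite leq_mul2r leq_maxl orbT.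
apply: leq_trans (_ : L2 * (L0 * L3) * word_dist S (fixed_val x) (fixed_val y) <= _);
  last by rewrite leq_mul2r leq_maxr orbT.
apply: leq_trans (hL2 x y) _; rewrite -!mulnA leq_mul2l; apply/orP; right.
by apply: leq_trans (hL0 x y) _; rewrite leq_mul2l hL3 orbT.
Qed.

(** Let [h i] be an element of the fixed subgroup near the point at time
    [(x i | sigma (x i))_1] of a geodesic from 1 to [x i].  Then
    [(x i | h i)_1] differs from that time by a bounded amount, so it tends to
    infinity. *)
Lemma fixed_sequence (x : nat -> G) : gromov2_diverges S x (sigma \o x) ->
  exists h : nat -> fixed_subgroup sigma, gromov2_diverges S x (@fixed_val _ sigma \o h).
Proof.
have [D' hypS'] := orbit_seq_hyperbolic; have gm := word_dist_graph_metric genS'.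
have dC := gm_sym gm; have dT := gm_triangle gm.
have iso := orbit_seq_isometry m_gt0 sigma_m genS.
move=> /gromov2_diverges_orbit_seq xsx.
have xx : gromov2_diverges S' x x.
  exact: gromov2_diverges_refl hypS' _ _ xsx.
have [R hR] := fixed_near_geodesic genS' hypS' iso.
have near i : exists h : fixed_subgroup sigma,
    gromov2 (word_dist S') 1%g (x i) (sigma (x i)) <=
    gromov2 (word_dist S') 1%g (x i) (fixed_val h) + (2 * R + 1).
  have [g gg] := gm_geodesic gm 1%g (x i).
  set s := gromov2 _ _ _ (sigma _).
  have s2 : 2 * s./2 <= s by lia.
  have [h hh] := hR _ _ _ gg s2; exists h.
  have [sx _] := displacement_bound genS' hypS' iso gg s2.
  have := geodesicL gg sx; have := geodesicR gg sx.
  have := dT 1%g (fixed_val h) (g s./2); have := dT (x i) (g s./2) (fixed_val h).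
  rewrite /gromov2 (dC (x i) (g _)) (dC (fixed_val h) (g _)).
  rewrite (dC (fixed_val h) 1%g) (dC (x i) 1%g).
  lia.
have [h hh] := choice near.
exists h; apply/gromov2_diverges_orbit_seq => n.
have [N hN] := xsx (n + D' + 2 * R + 1); have [M hM] := xx (n + D').
exists (maxn N M) => i j Ni Nj; have := hypS' 1%g (x i) (x j) (fixed_val (h j)).
have := hN j j ltac:(lia) ltac:(lia); have := hM i j ltac:(lia) ltac:(lia).
by have := hh j; rewrite /=; lia.
Qed.

Variables (T : seq (fixed_subgroup sigma)) (genT : generates T).
Implicit Types (p : boundary T) (q : boundary S).
Let iota : UMagmaMorphism.type (fixed_subgroup sigma) G := @fixed_val _ sigma.

(** The graph of the map induced by the inclusion on boundaries.  The
    homeomorphism and its inverse are both chosen from it: being well defined and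
    injective, being total and onto, and the two continuities are then pairs of
    dual statements about the relation. *)
Definition boundary_inclusion p q :=
  exists2 h, sval p h & sval q (iota \o h).

Lemma fixed_subgroup_hyperbolic : exists D', hyperbolic (word_dist T) D'.
Proof.
have [L [h1 h2]] := fixed_undistorted genT.
exact: (embedding_hyperbolic (f := iota) (word_dist_graph_metric genS)
  (word_dist_graph_metric genT) h1 h2 hypS).
Qed.

Lemma iota_diverges (h k : nat -> fixed_subgroup sigma) :
  gromov2_diverges T h k <-> gromov2_diverges S (iota \o h) (iota \o k).
Proof.
have [L [h1 h2]] := fixed_undistorted genT.
exact: gromov2_diverges_image h1 h2 hypS h k.
Qed.

Lemma boundary_inclusion_mem p q h : boundary_inclusion p q ->
  sval p h -> sval q (iota \o h).
Proof.
have [D' hypT] := fixed_subgroup_hyperbolic.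
move=> [k pk qk] ph; apply/(boundary_memP genS hypS _ qk)/iota_diverges.
exact/(boundary_memP genT hypT _ pk).
Qed.

Lemma boundary_inclusion_total p : exists q, boundary_inclusion p q.
Proof.
have [D' hypT] := fixed_subgroup_hyperbolic.
have [h ph] := boundary_nonempty p.
have [|q qh] := @boundary_point _ S genS (iota \o h).
  by apply/iota_diverges; apply/(boundary_memP genT hypT _ ph).
by exists q, h.
Qed.

Lemma boundary_inclusion_fun p q q' :
  boundary_inclusion p q -> boundary_inclusion p q' -> q = q'.
Proof.
move=> [h ph qh] /boundary_inclusion_mem/(_ ph).
exact: (boundary_ext genS hypS qh).
Qed.

Lemma boundary_inclusion_inj p p' q :
  boundary_inclusion p q -> boundary_inclusion p' q -> p = p'.
Proof.
have [D' hypT] := fixed_subgroup_hyperbolic.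
move=> [h ph qh] [h' ph' qh']; apply: (boundary_ext genT hypT ph).
apply/(boundary_memP genT hypT _ ph')/iota_diverges.
exact/(boundary_memP genS hypS _ qh').
Qed.

(** The class of [iota \o h] is stable under sigma, since sigma fixes this
    sequence and preserves equivalence.  The converse inclusion uses that the
    inverse of sigma is an iterate of it. *)
Lemma boundary_inclusion_fixed p q : boundary_inclusion p q ->
  boundary_fixed S sigma q.
Proof.
move=> [h ph qh].
have sh : sigma \o (iota \o h) = iota \o h.
  by apply/funext => i /=; apply: sigma_fixed_val.
have sq y : sval q y -> sval q (sigma \o y).
  move=> /(boundary_memP genS hypS _ qh)/gromov2_diverges_sigma; rewrite sh.
  by move=> sy; apply/(boundary_memP genS hypS _ qh).
rewrite /boundary_fixed /=; apply/seteqP; split=> [_ [y qy <-]|y qy]; first exact: sq.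
exists (iter m.-1 sigma \o y).
  elim: m.-1 => // k; rewrite (_ : iter k.+1 _ \o y = sigma \o (iter k sigma \o y)) //.
  exact: sq.
by apply/funext => i /=; rewrite -iterS prednK //; apply: sigma_m.
Qed.

Lemma boundary_inclusion_onto q : boundary_fixed S sigma q ->
  exists p, boundary_inclusion p q.
Proof.
have [D' hypT] := fixed_subgroup_hyperbolic.
rewrite /boundary_fixed /boundary_map /= => fixq.
have [x qx] := boundary_nonempty q.
have qsx : sval q (sigma \o x) by rewrite -fixq; exists x.
have [h xh] := fixed_sequence ((boundary_memP genS hypS _ qx).1 qsx).
have qh : sval q (iota \o h) by apply/(boundary_memP genS hypS _ qx).
have [|p ph] := @boundary_point _ T genT h; last by exists p, h.
by apply/iota_diverges; apply/(boundary_memP genS hypS _ qh).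
Qed.

Lemma boundary_inclusion_ball n : exists n' : nat, forall p p' q q',
  boundary_inclusion p q -> boundary_inclusion p' q' ->
  boundary_ball p (n'%:R / 2)%R p' -> boundary_ball q (n%:R / 2)%R q'.
Proof.
have [L [h1 h2]] := fixed_undistorted genT.
have [n' hn'] := gromov2_eventually_image (f := iota) genT genS h1 h2 hypS n.
exists n' => p p' q q' pq pq' [h [k [ph pk hk]]].
apply: (boundary_ball_mem genS (boundary_inclusion_mem pq ph)
  (boundary_inclusion_mem pq' pk)).
exact/hn'/(eventually_geP genT).
Qed.

Lemma boundary_inclusion_ball_reflect n : exists n' : nat, forall p p' q q',
  boundary_inclusion p q -> boundary_inclusion p' q' ->
  boundary_ball q (n'%:R / 2)%R q' -> boundary_ball p (n%:R / 2)%R p'.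
Proof.
have [L [h1 h2]] := fixed_undistorted genT.
have [n' hn'] := gromov2_eventually_reflect (f := iota) genT genS h1 h2 hypS n.
exists (n' + 2 * D) => p p' q q' [h ph qh] [k pk qk] qq'.
apply: (boundary_ball_mem genT ph pk); apply: hn'.
exact: (boundary_ball_eventually genS hypS qh qk qq').
Qed.

Lemma boundary_fixed_homeomorphic :
  homeomorphic (boundary_fixed S sigma) (boundary T).
Proof.
have [D' hypT] := fixed_subgroup_hyperbolic.
have [f hf] := choice (fun z : boundary_fixed S sigma =>
  boundary_inclusion_onto (set_valP z)).
have inv p : exists z : boundary_fixed S sigma, boundary_inclusion p (set_val z).
  have [q pq] := boundary_inclusion_total p.
  by exists (SigSub (mem_set (boundary_inclusion_fixed pq))).
have [g hg] := choice inv.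
exists f, g; split.
- move=> z A /(nbhs_boundaryP genT hypT)[n nA].
  have [n' hn'] := boundary_inclusion_ball_reflect n.
  have nz : nbhs z (set_val @^-1` boundary_ball (set_val z) (n'%:R / 2)%R)%classic.
    exact: initial_continuous (nbhs_boundary_ball genS hypS _ _).
  apply: filterS nz => z' zz'.
  by apply: nA; apply: hn' (hf z) (hf z') zz'.
- apply: (@continuous_comp_initial _ _ _ (set_val : boundary_fixed S sigma -> boundary S)).
  move=> p A /(nbhs_boundaryP genS hypS)[n nA].
  have [n' hn'] := boundary_inclusion_ball n.
  apply: filterS (nbhs_boundary_ball genT hypT p (n'%:R / 2)%R) => p' pp'.
  by apply: nA; apply: hn' (hg p) (hg p') pp'.
- by move=> z; apply: val_inj; apply: boundary_inclusion_fun (hg _) (hf _).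
- by move=> p; apply: boundary_inclusion_inj (hf _) (hg _).
Qed.

End FixedBoundary.

Theorem proposition2p1 (Gamma : groupType)
    (sigma : UMagmaMorphism.type Gamma Gamma) (m : nat) :
  hyperbolic_group Gamma ->
  automorphism_of_order sigma m ->
  hyperbolic_group (fixed_subgroup sigma) /\
  forall (S : seq Gamma) (T : seq (fixed_subgroup sigma)),
    generates S -> generates T ->
    homeomorphic (boundary_fixed S sigma) (boundary T).
Proof.
move=> [S0 genS0 /(hyperbolic_wrtP genS0)[D0 hyp0]] [_ m_gt0 sigma_m _]; split.
  have [D' hyp'] := orbit_seq_hyperbolic sigma m_gt0 genS0 hyp0.
  have [T genT _] := fixed_subgroup_undistorted (orbit_seq_generates sigma m_gt0 genS0)
    hyp' (orbit_seq_isometry m_gt0 sigma_m genS0).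
  exists T => //; apply/(hyperbolic_wrtP genT).
  exact: fixed_subgroup_hyperbolic m_gt0 sigma_m _ _ genS0 hyp0 _ genT.
move=> S T genS genT; have [D hypS] := hyperbolic_generators genS0 genS hyp0.
exact: boundary_fixed_homeomorphic m_gt0 sigma_m _ _ genS hypS _ genT.
Qed.
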